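(* Let $(b_\nu)_{\nu\in\mathbb{Z}_{\ge 0}^2}$ be a family of quaternions and let $$\rho=\limsup_{n\to\infty}\Bigl(\max_{\|\nu\|=n}\Bigl\|\frac{b_\nu}{n!}\Bigr\|\Bigr)^{1/n},\qquad \tau=\limsup_{n\to\infty}\Bigl(\sum_{\substack{0\le s\le n\\ b_{(s,n-s)}\ne0}}\binom{n}{s}\Bigr)^{1/n}.$$ Then the series $$g(x)=\sum_{n=0}^\infty\ \sum_{\substack{\nu=(s,t)\\ s+t=n}} S_\nu(x)\, b_\nu$$ converges compactly on $\{x\in\mathbb{V} : \|x\|_1'<\tfrac{1}{\tau\rho}\}$.
   Context: $\mathbb{H}$ denotes the quaternions with imaginary units $i,j,k$ ($i^2=j^2=k^2=ijk=-1$) and Euclidean norm $\|\cdot\|$; $\mathbb{V}\subset\mathbb{H}$ is the real vector space spanned by $i,j,k$, with elements $v=iv_1+jv_2+kv_3$, $v_1,v_2,v_3\in\mathbb{R}$. Define $\xi_2,\xi_3:\mathbb{V}\to\mathbb{H}$ by $\xi_2(v)=v_2-i^{-1}j\,v_1$ and $\xi_3(v)=v_3-i^{-1}k\,v_1$. For $\nu=(s,t)\in\mathbb{Z}_{\ge0}^2$ put $\|\nu\|=s+t=n$, let $B_\nu$ be the set of all words $(i_1,\dots,i_n)$ with exactly $s$ letters $2$ and $t$ letters $3$, and define $$S_\nu(v)=\frac1{n!}\sum_{(i_1,\dots,i_n)\in B_\nu}\xi_{i_1}(v)\cdots\xi_{i_n}(v)$$ (the product over the empty word is $1$). An empty sum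 is $0$. The auxiliary norm on $\mathbb{V}$ is $\|iv_1+jv_2+kv_3\|_1'=\max\{\|v_2-i^{-1}jv_1\|,\|v_3-i^{-1}kv_1\|\}$. Conventions: $1/(\tau\rho)=\infty$ if $\tau\rho=0$ (the set is then all of $\mathbb{V}$) and $1/(\tau\rho)=0$ if $\rho=\infty$ (the set is then empty; in this case $\tau\ge1$). A series $\sum_n\sum_{\|\nu\|=n}S_\nu b_\nu$ converges compactly on an open set if its partial sums over $n\le N$ converge, as $N\to\infty$, uniformly on every compact subset of that set. *)

(* Defs.v *)
(* MathComp / MathComp-Analysis *)
From HB Require Import structures.
From mathcomp Require Import all_boot all_order all_algebra.
From mathcomp Require Import ring lra.
From mathcomp Require Import all_classical all_reals all_analysis.
Set Implicit Arguments.
Unset Strict Implicit.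
Unset Printing Implicit Defensive.
Import Order.TTheory GRing.Theory Num.Theory.
Import numFieldNormedType.Exports.
Local Open Scope classical_set_scope.
Local Open Scope ring_scope.

(* Quat a b c d stands for a + i b + j c + k d. *)
Record quat (R : realType) := Quat { qre : R; qim1 : R; qim2 : R; qim3 : R }.

Section QuaternionAlgebra.
Variable R : realType.
Implicit Types (x y z : quat R) (a : R).

Definition quat_tuple x := (qre x, qim1 x, qim2 x, qim3 x).
Definition tuple_quat (p : R * R * R * R) :=
  let: (a, b, c, d) := p in Quat a b c d.
Lemma quat_tupleK : cancel quat_tuple tuple_quat. Proof. by case. Qed.

HB.instance Definition _ := Choice.copy (quat R) (can_type quat_tupleK).

Definition quat_add x y :=
  Quat (qre x + qre y) (qim1 x + qim1 y) (qim2 x + qim2 y) (qim3 x + qim3 y).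
Definition quat_opp x := Quat (- qre x) (- qim1 x) (- qim2 x) (- qim3 x).
Definition quat_scale a x :=
  Quat (a * qre x) (a * qim1 x) (a * qim2 x) (a * qim3 x).
Definition quat_mul x y := Quat
  (qre x * qre y - qim1 x * qim1 y - qim2 x * qim2 y - qim3 x * qim3 y)
  (qre x * qim1 y + qim1 x * qre y + qim2 x * qim3 y - qim3 x * qim2 y)
  (qre x * qim2 y - qim1 x * qim3 y + qim2 x * qre y + qim3 x * qim1 y)
  (qre x * qim3 y + qim1 x * qim2 y - qim2 x * qim1 y + qim3 x * qre y).
Definition quat_sqnorm x :=
  qre x ^+ 2 + qim1 x ^+ 2 + qim2 x ^+ 2 + qim3 x ^+ 2.
Definition quat_conj x := Quat (qre x) (- qim1 x) (- qim2 x) (- qim3 x).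
Definition quat_inv x := quat_scale (quat_sqnorm x)^-1 (quat_conj x).
Definition quat_norm x := Num.sqrt (quat_sqnorm x).

Fact quat_addA : associative quat_add.
Proof. by move=> x y z; rewrite /quat_add /= !addrA. Qed.
Fact quat_addC : commutative quat_add.
Proof. by move=> x y; congr Quat; exact: addrC. Qed.
Fact quat_add0 : left_id (Quat 0 0 0 0) quat_add.
Proof. by case=> a b c d; rewrite /quat_add /= !add0r. Qed.
Fact quat_addN : left_inverse (Quat 0 0 0 0) quat_opp quat_add.
Proof. by case=> a b c d; rewrite /quat_add /= !addNr. Qed.
HB.instance Definition _ :=
  GRing.isZmodule.Build (quat R) quat_addA quat_addC quat_add0 quat_addN.

Lemma quat_eq x y : qre x = qre y -> qim1 x = qim1 y -> qim2 x = qim2 y ->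
  qim3 x = qim3 y -> x = y.
Proof. by case: x y => [? ? ? ?] [? ? ? ?] /= -> -> -> ->. Qed.

Lemma qreD x y : qre (x + y) = qre x + qre y. Proof. by []. Qed.
Lemma qim1D x y : qim1 (x + y) = qim1 x + qim1 y. Proof. by []. Qed.
Lemma qim2D x y : qim2 (x + y) = qim2 x + qim2 y. Proof. by []. Qed.
Lemma qim3D x y : qim3 (x + y) = qim3 x + qim3 y. Proof. by []. Qed.
Definition quatDE := (qreD, qim1D, qim2D, qim3D).

Fact quat_mulA : associative quat_mul.
Proof. by move=> x y z; apply: quat_eq => /=; ring. Qed.
Fact quat_mul1 : left_id (Quat 1 0 0 0) quat_mul.
Proof. by move=> x; apply: quat_eq => /=; ring. Qed.
Fact quat_mulr1 : right_id (Quat 1 0 0 0) quat_mul.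
Proof. by move=> x; apply: quat_eq => /=; ring. Qed.
Fact quat_mulDl : left_distributive quat_mul +%R.
Proof. by move=> x y z; apply: quat_eq; rewrite !quatDE /= ?quatDE; ring. Qed.
Fact quat_mulDr : right_distributive quat_mul +%R.
Proof. by move=> x y z; apply: quat_eq; rewrite !quatDE /= ?quatDE; ring. Qed.
Fact quat_1neq0 : Quat 1 0 0 0 != 0 :> quat R.
Proof. by apply/eqP => -[] /eqP; rewrite oner_eq0. Qed.
HB.instance Definition _ := GRing.Zmodule_isNzRing.Build (quat R)
  quat_mulA quat_mul1 quat_mulr1 quat_mulDl quat_mulDr quat_1neq0.

Fact quat_scaleA a b x : quat_scale a (quat_scale b x) = quat_scale (a * b) x.
Proof. by rewrite /quat_scale /= !mulrA. Qed.
Fact quat_scale1 : left_id 1 quat_scale.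
Proof. by case=> a b c d; rewrite /quat_scale /= !mul1r. Qed.
Fact quat_scaleDr : right_distributive quat_scale +%R.
Proof. by move=> a x y; apply: quat_eq; exact: mulrDr. Qed.
Fact quat_scaleDl x : {morph quat_scale^~ x : a b / a + b}.
Proof. by move=> a b; apply: quat_eq; exact: mulrDl. Qed.
HB.instance Definition _ := GRing.Zmodule_isLmodule.Build R (quat R)
  quat_scaleA quat_scale1 quat_scaleDr quat_scaleDl.

Fact quat_scaleAl a x y :
  quat_scale a (quat_mul x y) = quat_mul (quat_scale a x) y.
Proof. by apply: quat_eq => /=; ring. Qed.
HB.instance Definition _ :=
  GRing.Lmodule_isLalgebra.Build R (quat R) quat_scaleAl.
Fact quat_scaleAr a x y :
  quat_scale a (quat_mul x y) = quat_mul x (quat_scale a y).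
Proof. by apply: quat_eq => /=; ring. Qed.
HB.instance Definition _ :=
  GRing.Lalgebra_isAlgebra.Build R (quat R) quat_scaleAr.

Lemma quat_sqnorm_ge0 x : 0 <= quat_sqnorm x.
Proof. by rewrite !addr_ge0 ?sqr_ge0. Qed.

Lemma quat_sqnorm_eq0 x : (quat_sqnorm x == 0) = (x == 0).
Proof.
apply/eqP/eqP => [|->]; last by rewrite /quat_sqnorm /= expr0n !addr0.
case: x => a b c d; rewrite /quat_sqnorm /= => /eqP.
rewrite !paddr_eq0 ?addr_ge0 ?sqr_ge0 // !sqrf_eq0.
by case/andP=> /andP[/andP[/eqP-> /eqP->] /eqP->] /eqP->.
Qed.

Fact quat_mulVx : {in [pred x | x != 0], left_inverse 1 quat_inv *%R}.
Proof.
move=> x; rewrite inE -quat_sqnorm_eq0 => x0.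
have {x0} : (quat_sqnorm x)^-1 * quat_sqnorm x = 1 by rewrite mulVf.
change ((quat_sqnorm x)^-1 * quat_sqnorm x = 1 ->
  quat_mul (quat_inv x) x = Quat 1 0 0 0).
rewrite /quat_inv; move: (quat_sqnorm x)^-1 => u; rewrite /quat_sqnorm => E.
by apply: quat_eq => /=; rewrite -?E; ring.
Qed.
Fact quat_mulxV : {in [pred x | x != 0], right_inverse 1 quat_inv *%R}.
Proof.
move=> x; rewrite inE -quat_sqnorm_eq0 => x0.
have {x0} : (quat_sqnorm x)^-1 * quat_sqnorm x = 1 by rewrite mulVf.
change ((quat_sqnorm x)^-1 * quat_sqnorm x = 1 ->
  quat_mul x (quat_inv x) = Quat 1 0 0 0).
rewrite /quat_inv; move: (quat_sqnorm x)^-1 => u; rewrite /quat_sqnorm => E.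
by apply: quat_eq => /=; rewrite -?E; ring.
Qed.
Fact quat_unitP x y : y * x = 1 /\ x * y = 1 -> [pred x | x != 0] x.
Proof.
by case=> /eqP + _; apply: contraTneq => ->; rewrite mulr0 eq_sym oner_eq0.
Qed.
Fact quat_inv_out : {in [predC [pred x | x != 0]], quat_inv =1 id}.
Proof.
move=> x; rewrite !inE negbK => /eqP->.
by rewrite /quat_inv /quat_scale /= !oppr0 !mulr0.
Qed.
HB.instance Definition _ := GRing.NzRing_hasMulInverse.Build (quat R)
  quat_mulVx quat_mulxV quat_unitP quat_inv_out.

Fact quat_normD x y : quat_norm (x + y) <= quat_norm x + quat_norm y.
Proof.
rewrite -(@ler_pXn2r _ 2) ?nnegrE ?addr_ge0 ?sqrtr_ge0 // sqrrD.
rewrite !sqr_sqrtr ?quat_sqnorm_ge0 //.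
rewrite -sqrtrM ?quat_sqnorm_ge0 //.
set p := qre x * qre y + qim1 x * qim1 y + qim2 x * qim2 y + qim3 x * qim3 y.
have pxy : p <= Num.sqrt (quat_sqnorm x * quat_sqnorm y).
  apply: le_trans (ler_norm p) _; rewrite -sqrtr_sqr ler_wsqrtr //.
  rewrite -subr_ge0 [leRHS](_ : _ =
    (qre x * qim1 y - qim1 x * qre y) ^+ 2
    + (qre x * qim2 y - qim2 x * qre y) ^+ 2
    + (qre x * qim3 y - qim3 x * qre y) ^+ 2
    + (qim1 x * qim2 y - qim2 x * qim1 y) ^+ 2
    + (qim1 x * qim3 y - qim3 x * qim1 y) ^+ 2
    + (qim2 x * qim3 y - qim3 x * qim2 y) ^+ 2).
    by rewrite !addr_ge0 ?sqr_ge0.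
  by rewrite /p /quat_sqnorm; ring.
rewrite [leLHS](_ : _ = quat_sqnorm x + p *+ 2 + quat_sqnorm y).
  by rewrite lerD2r lerD2l lerMn2r pxy orbT.
by rewrite /p /quat_sqnorm /=; ring.
Qed.
Fact quat_normZ a x : quat_norm (a *: x) = `|a| * quat_norm x.
Proof.
rewrite /quat_norm -sqrtr_sqr -sqrtrM ?sqr_ge0 //; congr Num.sqrt.
by rewrite /quat_sqnorm /=; ring.
Qed.
Fact quat_norm0_eq0 x : quat_norm x = 0 -> x = 0.
Proof.
move/eqP; rewrite sqrtr_eq0 => x0; apply/eqP.
by rewrite -quat_sqnorm_eq0 eq_le x0 quat_sqnorm_ge0.
Qed.
(* Makes `|x| the Euclidean norm, and the topology the one it induces. *)
HB.instance Definition _ := Lmodule_isNormed.Build R (quat R)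
  quat_normD quat_normZ quat_norm0_eq0.

Definition qi : quat R := Quat 0 1 0 0.
Definition qj : quat R := Quat 0 0 1 0.
Definition qk : quat R := Quat 0 0 0 1.

Lemma quat_relations :
  [/\ qi ^+ 2 = -1, qj ^+ 2 = -1, qk ^+ 2 = -1 & qi * qj * qk = -1].
Proof.
by split; rewrite ?expr2; apply: quat_eq => /=; ring.
Qed.

End QuaternionAlgebra.

Section QuaternionSeries.
Variable R : realType.
Local Notation H := (quat R).

Definition vect : set H :=
  [set v | exists v1 v2 v3 : R, v = v1 *: qi R + v2 *: qj R + v3 *: qk R].

(* Functions on vect are written as functions on all of H; they ignore the
   real part of their argument. *)
Definition xi2 (v : H) : H := (qim2 v)%:A - (qi R)^-1 * qj R * (qim1 v)%:A.
Definition xi3 (v : H) : H := (qim3 v)%:A - (qi R)^-1 * qk R * (qim1 v)%:A.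

(* Words in the letters 2 and 3 are boolean sequences: false is the letter 2
   and true is the letter 3. *)
Definition xi (l : bool) : H -> H := if l then xi3 else xi2.

Definition words (nu : nat * nat) : {set (nu.1 + nu.2).-tuple bool} :=
  [set w : (nu.1 + nu.2).-tuple bool |
    (count_mem false w == nu.1) && (count_mem true w == nu.2)]%SET.

Definition Snu (nu : nat * nat) (v : H) : H :=
  ((nu.1 + nu.2)`!%:R^-1 : R) *:
    \sum_(w in words nu) \prod_(l <- w) xi l v.

Definition norm1' (v : H) : R := Num.max `|xi2 v| `|xi3 v|.

Variable b : nat * nat -> H.

(* In the next two definitions the term n = 0 does not affect the limsup. *)
Definition rho : \bar R := limn_esup (fun n =>
  ((\big[Num.max/0]_(0 <= s < n.+1) `|(n`!%:R^-1 : R) *: b (s, n - s)%N|)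
     `^ n%:R^-1)%:E).

Definition tau : \bar R := limn_esup (fun n =>
  (((\sum_(0 <= s < n.+1 | b (s, n - s)%N != 0%R) 'C(n, s))%N%:R : R)
     `^ n%:R^-1)%:E).

(* The inverse on \bar R satisfies 0^-1 = +oo and +oo^-1 = 0; the product
   0 * +oo does not occur, since tau >= 1 when rho = +oo. *)
Definition conv_radius : \bar R := ((tau * rho)^-1)%E.

Definition conv_domain : set H :=
  [set x | vect x /\ ((norm1' x)%:E < conv_radius)%E].

Definition partial_sum (N : nat) (x : H) : H :=
  \sum_(0 <= n < N.+1) \sum_(0 <= s < n.+1)
    Snu (s, n - s)%N x * b (s, n - s)%N.

End QuaternionSeries.

(* compactly_in D is the family of all compact subsets of D; since it contains
   the singletons, the limit g is the pointwise limit of f on D. *)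
Definition converges_compactly (U : topologicalType) (V : uniformType)
    (f : nat -> U -> V) (D : set U) : Prop :=
  exists g : U -> V, {family compactly_in D, f @ \oo --> g}.

(* Main.v *)
(* The Euclidean norm is multiplicative and S_nu is a sum over binom(n, s) words,
   so |S_nu(x)| <= binom(n, s) / n! * |x|_1'^n.  The homogeneous part of degree
   n is therefore at most T_n M_n |x|_1'^n, where rho = limsup M_n^(1/n) and
   tau = limsup T_n^(1/n).  On a compact subset of the domain |.|_1' attains its
   maximum, which is below 1/(tau rho); the root test then gives a geometric
   majorant and the Weierstrass M-test applies. *)
From HB Require Import structures.
Require Import Defs.
From mathcomp Require Import all_boot all_order all_algebra.
From mathcomp Require Import ring lra.
From mathcomp Require Import all_classical all_reals all_analysis.
Set Implicit Arguments.
Unset Strict Implicit.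
Unset Printing Implicit Defensive.
Import Order.TTheory GRing.Theory Num.Theory.
Import numFieldNormedType.Exports.
Local Open Scope classical_set_scope.
Local Open Scope ring_scope.

(** * Multiplicativity of the quaternion norm and completeness *)

Lemma quat_normE (R : realType) (x : quat R) : `|x| = Num.sqrt (quat_sqnorm x).
Proof. by []. Qed.

Lemma quat_mulE (R : realType) (x y : quat R) : x * y = quat_mul x y.
Proof. by []. Qed.

(** Euler's four-square identity, taken under the square root. *)
Lemma quat_normM (R : realType) (x y : quat R) : `|x * y| = `|x| * `|y|.
Proof.
rewrite !quat_normE -sqrtrM ?quat_sqnorm_ge0 //; congr Num.sqrt.
by rewrite quat_mulE /quat_sqnorm /=; ring.
Qed.

Lemma quat_norm1 (R : realType) : `|1 : quat R| = 1.
Proof. by rewrite quat_normE /quat_sqnorm /= expr1n expr0n !addr0 sqrtr1. Qed.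

Lemma quat_norm_component (R : realType) (x : quat R) :
  [/\ `|qre x| <= `|x|, `|qim1 x| <= `|x|, `|qim2 x| <= `|x|
    & `|qim3 x| <= `|x|].
Proof.
by split; rewrite quat_normE -sqrtr_sqr ler_wsqrtr // /quat_sqnorm;
  move: (sqr_ge0 (qre x)) (sqr_ge0 (qim1 x)) (sqr_ge0 (qim2 x))
    (sqr_ge0 (qim3 x)); lra.
Qed.

Lemma quat_basis (R : realType) (x : quat R) :
  x = qre x *: 1 + qim1 x *: qi R + qim2 x *: qj R + qim3 x *: qk R.
Proof. by apply: quat_eq; rewrite !quatDE /=; ring. Qed.

Section Components.
Variables (R : realType) (p : quat R -> R).
Hypothesis pB : forall x y, p (x - y) = p x - p y.
Hypothesis p_le : forall x, `|p x| <= `|x|.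

(** Here [p] stands for any of the four real coordinates; [pB] and [p_le] make it 1-Lipschitz. *)
Lemma component_continuous : continuous p.
Proof.
move=> x.
apply: (proj2 (@cvgrPdist_lt _ _ _ (nbhs x) (nbhs_filter x) _ _)) => e e0.
apply: (@filterS _ (nbhs x) (nbhs_filter x)) (nbhsx_ballx x e e0) => y.
by rewrite -ball_normE /= -pB; apply: le_lt_trans (p_le _).
Qed.

Lemma component_cauchy (F : set_system (quat R)) :
  ProperFilter F -> cauchy F -> cvg (p @ F).
Proof.
move=> FF /cauchy_ballP cF; apply: cauchy_cvg; apply/cauchy_ballP => e e0.
have [[A B] [/= FA FB] AB] := cF e e0.
exists (p @` A, p @` B) => /=.
  by split; [apply: filterS FA | apply: filterS FB] => x ?; exists x.
move=> [_ _] /= [[x Ax <-] [y By <-]].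
have := AB (x, y) (conj Ax By).
by rewrite -!ball_normE /= -pB; apply: le_lt_trans (p_le _).
Qed.
End Components.

(** The coordinates of a Cauchy filter converge in [R], and [quat_basis] reassembles the limit. The
    M-test below requires a complete target space. *)
Lemma quat_complete (R : realType) (F : set_system (quat R)) :
  ProperFilter F -> cauchy F -> cvg F.
Proof.
move=> FF cF.
have c0 : cvg (@qre R @ F).
  by apply: component_cauchy => // x; case: (quat_norm_component x).
have c1 : cvg (@qim1 R @ F).
  by apply: component_cauchy => // x; case: (quat_norm_component x).
have c2 : cvg (@qim2 R @ F).
  by apply: component_cauchy => // x; case: (quat_norm_component x).
have c3 : cvg (@qim3 R @ F).
  by apply: component_cauchy => // x; case: (quat_norm_component x).
have : cvg ((fun x => qre x *: 1 + qim1 x *: qi R + qim2 x *: qj R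
  + qim3 x *: qk R) @ F).
  by do !apply: is_cvgD; apply: is_cvgZr_tmp.
by under eq_fun do rewrite -quat_basis.
Qed.

HB.instance Definition _ (R : realType) :=
  Uniform_isComplete.Build (quat R) (@quat_complete R).

(** * The auxiliary norm and the bound on [Snu] *)

Lemma norm1'_continuous (R : realType) : continuous (@norm1' R).
Proof.
have c1 : continuous (@qim1 R).
  by apply: component_continuous => // x; case: (quat_norm_component x).
have c2 : continuous (@qim2 R).
  by apply: component_continuous => // x; case: (quat_norm_component x).
have c3 : continuous (@qim3 R).
  by apply: component_continuous => // x; case: (quat_norm_component x).
(* Common shape of [xi2] and [xi3]: [p] is the second or third imaginary part and [c] is
   [qi^-1 * qj] or [qi^-1 * qk]. *)
have cxi (p : quat R -> R) (c : quat R) : continuous p ->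
    continuous (fun v => `|(p v)%:A - c * (qim1 v)%:A|).
  move=> cp x; have nx := nbhs_filter x.
  have -> : (fun v => `|(p v)%:A - c * (qim1 v)%:A|) =
      (fun v => `|p v *: 1 - qim1 v *: c|).
    by apply/funext => v; rewrite -scalerAr mulr1.
  apply: (@cvg_norm _ _ _ _ nx); apply: (@cvgB _ _ _ _ nx).
    exact: (@cvgZr_tmp _ _ _ _ nx _ _ _ (cp x)).
  exact: (@cvgZr_tmp _ _ _ _ nx _ _ _ (c1 x)).
move=> x; apply: (@continuous_max R _ (fun v => `|xi2 v|) (fun v => `|xi3 v|));
  exact: cxi.
Qed.

(** A word is determined by the set of positions of its letter 2, a subset of size [nu.1]. *)
Lemma card_words_le (nu : nat * nat) : (#|words nu| <= 'C(nu.1 + nu.2, nu.1))%N.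
Proof.
set n := (nu.1 + nu.2)%N.
pose f (w : n.-tuple bool) := [set i | ~~ tnth w i]%SET.
have f_inj : injective f.
  move=> w w' /setP E; apply: eq_from_tnth => i.
  by have := E i; rewrite !inE => /negb_inj.
rewrite -[X in 'C(X, _)]card_ord -card_draws -(card_imset _ f_inj).
apply: subset_leq_card; apply/fintype.subsetP => _ /imsetP[w + ->].
rewrite !inE => /andP[/eqP wE _]; apply/eqP; rewrite -[RHS]wE.
rewrite -sum1_count big_tuple -sum1_card.
by apply: eq_bigl => i; rewrite inE /= eqbF_neg.
Qed.

Lemma norm_prod_xi (R : realType) (w : seq bool) (v : quat R) :
  `|\prod_(l <- w) xi l v| <= norm1' v ^+ size w.
Proof.
elim: w => [|l w IH]; first by rewrite big_nil expr0 quat_norm1.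
rewrite big_cons quat_normM exprS; apply: ler_pM => //.
by rewrite /norm1' le_max /xi; case: l; rewrite lexx ?orbT.
Qed.

Lemma norm1'_ge0 (R : realType) (v : quat R) : 0 <= norm1' v.
Proof. by rewrite /norm1' le_max normr_ge0. Qed.

Lemma norm_Snu_le (R : realType) (nu : nat * nat) (v : quat R) :
  `|Snu nu v| <=
  'C(nu.1 + nu.2, nu.1)%:R / (nu.1 + nu.2)`!%:R * norm1' v ^+ (nu.1 + nu.2).
Proof.
rewrite /Snu normrZ ger0_norm ?invr_ge0 // [X in _ <= X * _]mulrC -mulrA.
apply: ler_wpM2l; rewrite ?invr_ge0 //.
apply: le_trans (ler_norm_sum _ _ _) _.
apply: (@le_trans _ _ (\sum_(w in words nu) norm1' v ^+ (nu.1 + nu.2))).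
  by apply: ler_sum => w _; rewrite -[X in _ ^+ X](size_tuple w) norm_prod_xi.
rewrite sumr_const -[X in X <= _]mulr_natl ler_wpM2r ?exprn_ge0 ?norm1'_ge0 //.
by rewrite ler_nat card_words_le.
Qed.

(** * Uniform convergence by domination *)

Lemma weierstrass_M_test (R : realType) (U : choiceType)
    (V : completeNormedModType R) (u : nat -> U -> V) (fam : set U -> Prop) :
  (forall A, fam A -> exists2 M : nat -> R, cvgn (series M) &
    \forall n \near \oo, forall x, A x -> `|u n x| <= M n) ->
  exists g : U -> V,
    {family fam, (fun N x => series (u^~ x) N) @ \oo --> g}.
Proof.
move=> uM; exists (fun x => limn (series (u^~ x))).
apply/fam_cvgP => A /uM[M /cvg_cauchy/cauchy_seriesP cM [N0 _ uMle]].
(* The rank depends on [A] and [e] but not on [x]: beyond [N0], differences of partial sums are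
   dominated by blocks of the convergent series of [M]. *)
have tail e : 0 < e -> exists N, forall x m n, A x -> (N <= m)%N ->
    (N <= n)%N -> `|series (u^~ x) m - series (u^~ x) n| <= e.
  move=> /cM[[P Q] [[N1 _ NP] [N2 _ NQ]] PQ].
  exists (maxn N0 (maxn N1 N2)) => x + + Ax.
  suff le m n : (maxn N0 (maxn N1 N2) <= m)%N -> (m <= n)%N ->
      `|series (u^~ x) n - series (u^~ x) m| <= e.
    move=> m n Nm Nn; have [nm|/ltnW mn] := leqP n m; first exact: le.
    by rewrite distrC; exact: le.
  rewrite !geq_max => /and3P[N0m N1m N2m] mn.
  rewrite sub_series mn; apply: le_trans (ler_norm_sum _ _ _) _.
  apply: le_trans (_ : \sum_(m <= k < n) M k <= _).
    rewrite !big_nat; apply: ler_sum => k /andP[mk _].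
    by apply: uMle => //=; exact: leq_trans mk.
  apply: le_trans (ler_norm _) _; apply: ltW.
  apply: (PQ (m, n)); split; first exact: NP.
  by apply: NQ => /=; exact: leq_trans mn.
have cvgA x : A x -> cvgn (series (u^~ x)).
  move=> Ax; apply: cauchy_cvg; apply/cauchy_ballP => e e0.
  have [N tailN] := tail (e / 2) (divr_gt0 e0 (ltr0Sn _ 1)).
  exists ([set series (u^~ x) m | m in [set m | (N <= m)%N]],
          [set series (u^~ x) m | m in [set m | (N <= m)%N]]) => /=.
    by split; exists N => // m Nm; exists m.
  move=> [_ _] /= [[m Nm <-] [n Nn <-]].
  rewrite -ball_normE /=; apply: le_lt_trans (tailN x m n Ax Nm Nn) _.
  by rewrite ltr_pdivrMr // ltr_pMr // ltr1n.
move=> P /uniform_nbhs[E [+ EP]]; rewrite -entourage_ballE => -[e /= e0 eE].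
have [N tailN] := tail (e / 2) (divr_gt0 e0 (ltr0Sn _ 1)).
exists N => // n /= Nn; apply: EP => x Ax; apply: eE.
rewrite /= -ball_normE /=.
(* Letting [m] tend to infinity in [tail] bounds the distance to the pointwise limit; using [e / 2]
   recovers a strict inequality. *)
have C : `|series (u^~ x) m - series (u^~ x) n| @[m --> \oo] -->
    `|limn (series (u^~ x)) - series (u^~ x) n|.
  by apply: cvg_norm; apply: cvgB; [exact: cvgA|exact: cvg_cst].
apply: (@le_lt_trans _ _ (e / 2)); last first.
  by rewrite ltr_pdivrMr // ltr_pMr // ltr1n.
rewrite -(cvg_lim _ C) //; apply: limr_le.
  by apply/cvg_ex; eexists; exact: C.
by exists N => // m Nm; exact: tailN.
Qed.

(** * Limits superior and n-th roots *)

Lemma limn_esup_lt (R : realType) (u : nat -> \bar R) (l : \bar R) :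
  (limn_esup u < l)%E -> \forall n \near \oo, (u n < l)%E.
Proof.
(* The limsup is the infimum of the suprema of [u] over the sets of the filter, so one such supremum
   is already below [l]. *)
move=> /ereal_inf_lt[_ [A ooA <-] supAl].
apply: filterS ooA => n An; apply: le_lt_trans supAl.
by apply: ereal_sup_ubound; exists n.
Qed.

Lemma limn_esup_root_lt (R : realType) (u : nat -> R) (l : R) :
  (forall n, 0 <= u n) ->
  (limn_esup (fun n => (u n `^ n%:R^-1)%:E) < l%:E)%E ->
  \forall n \near \oo, u n <= l ^+ n.
Proof.
(* Starting at [N.+1] excludes [n = 0], where [n%:R^-1] is 0 and the root cannot be undone. *)
move=> u0 /limn_esup_lt [N _ ul]; exists N.+1 => // n /= Nn.
have n0 : n%:R != 0 :> R by rewrite pnatr_eq0 -lt0n (leq_trans _ Nn).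
have := ul n (ltnW Nn); rewrite lte_fin => /ltW uln.
rewrite -[u n]powRr1 // -(mulVf n0) powRrM powR_mulrn ?powR_ge0 //.
by rewrite lerXn2r // nnegrE ?powR_ge0 // (le_trans _ uln) ?powR_ge0.
Qed.

Lemma limn_esup_root_ge0 (R : realType) (u : nat -> R) :
  (0 <= limn_esup (fun n => (u n `^ n%:R^-1)%:E))%E.
Proof.
apply: limf_esup_ge0; last by move=> n; rewrite lee_fin powR_ge0.
exact: filter_not_empty.
Qed.

Lemma limn_esup_le (R : realType) (u : nat -> \bar R) (l : \bar R) :
  (\forall n \near \oo, (u n <= l)%E) -> (limn_esup u <= l)%E.
Proof.
move=> ul; apply: le_trans (_ : ereal_sup (u @` [set n | (u n <= l)%E]) <= _)%E.
  by apply: ereal_inf_lbound; exists [set n | (u n <= l)%E].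
by apply: ge_ereal_sup => _ [n un <-].
Qed.

(** * Geometric majorant for the homogeneous parts *)

Section RadiusOfConvergence.
Variables (R : realType) (b : nat * nat -> quat R).

Let M n : R :=
  \big[Num.max/0]_(0 <= s < n.+1) `|(n`!%:R^-1 : R) *: b (s, n - s)%N|.
Let T n : nat :=
  \sum_(0 <= s < n.+1 | b (s, n - s)%N != 0%R) 'C(n, s).

Lemma le_coef_max n s : (s <= n)%N ->
  `|(n`!%:R^-1 : R) *: b (s, n - s)%N| <= M n.
Proof.
move=> sn; apply: (@le_bigmax_seq _ _ _ _ 0 s xpredT) => //.
by rewrite mem_index_iota.
Qed.

Lemma coef_max_ge0 n : 0 <= M n.
Proof. by apply: le_trans (le_coef_max (leq0n n)). Qed.

(** [T n] is part of a full row of binomials, whose sum is [2 ^ n]. This makes [tau b] finite. *)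
Lemma tau_le2 : (tau b <= 2%:E)%E.
Proof.
apply: limn_esup_le; exists 1%N => // n /= n0.
rewrite lee_fin.
have nR0 : n%:R != 0 :> R by rewrite pnatr_eq0 -lt0n.
apply: le_trans (_ : ((2 ^ n)%:R : R) `^ n%:R^-1 <= _).
  rewrite ge0_ler_powR ?invr_ge0 ?nnegrE // ler_nat.
  rewrite big_mkord -[2%N]/(1 + 1)%N expnDn big_mkcond leq_sum // => i _.
  by case: ifP => // _; rewrite !exp1n !muln1.
by rewrite natrX -powR_mulrn // -powRrM mulfV // powRr1.
Qed.

(** Root test in three cases: for [tau b < 1] the parts vanish eventually; an infinite [rho b]
    leaves no admissible [r]; otherwise both limsups are finite and can be enlarged slightly. *)
Lemma homogeneous_bound_geometric (r : R) :
  0 <= r -> (r%:E < conv_radius b)%E ->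
  exists2 q, 0 <= q < 1 &
    \forall n \near \oo, (T n)%:R * M n * r ^+ n <= q ^+ n.
Proof.
move=> r0; rewrite /conv_radius.
have T0 n : 0 <= (T n)%:R :> R by [].
have tau0 : (0 <= tau b)%E := limn_esup_root_ge0 _.
have rho0 : (0 <= rho b)%E := limn_esup_root_ge0 _.
have [tau1|tau1] := ltP (tau b) 1%E.
  move=> _; exists 0; first by rewrite lexx ltr01.
  (* T n is a natural number, so T n `^ n^-1 < 1 forces T n = 0. *)
  have [N _ TN] := limn_esup_lt tau1.
  exists N => // n Nn; suff -> : T n = 0%N by rewrite !mul0r exprn_ge0.
  apply/eqP; rewrite -leqn0 leqNgt; apply/negP => Tn.
  have := TN n Nn; rewrite lte_fin ltNge => /negP; apply.
  rewrite -[X in X <= _](powRr0 (T n)%:R); apply: ler_powR.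
    by rewrite ler1n.
  by rewrite invr_ge0.
have /fineK taufin : tau b \is a fin_num.
  by rewrite ge0_fin_numE // (le_lt_trans tau_le2) ?ltry.
(* Since [tau b >= 1], an infinite [rho b] gives radius 0, against [0 <= r]. *)
have [rhoy|rhoy] := eqVneq (rho b) +oo%E.
  rewrite rhoy gt0_muley ?(lt_le_trans lte01) // invey lte_fin.
  by move=> /(le_lt_trans r0); rewrite ltxx.
have /fineK rhofin : rho b \is a fin_num by rewrite ge0_fin_numE // ltey.
move: tau1 rho0; rewrite -taufin -rhofin !lee_fin.
set t := fine (tau b); set p := fine (rho b) => t1 p0.
rewrite -EFinM => rtp.
have tpr : t * p * r < 1.
  have [->|p_neq0] := eqVneq p 0; first by rewrite mulr0 mul0r.
  have tp0 : 0 < t * p by rewrite mulr_gt0 ?lt_def ?p_neq0 //; lra.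
  move: rtp; rewrite inver gt_eqF // lte_fin => rtp.
  by rewrite mulrC -ltr_pdivlMr // mul1r.
have tpr0 : 0 <= t * p * r by rewrite !mulr_ge0 //; lra.
(* For [e <= 1], enlarging [t] and [p] by [e] raises [t * p * r] by at most [e * (t + p + 1) * r].
   Replacing [r] by [r + 1] keeps the final inequality strict even for [r = 0] and gives [D >= 1],
   hence [e <= 1]. *)
pose D := (t + p + 1) * (r + 1).
have D1 : 1 <= D by rewrite /D mulr_ege1 //; lra.
have [e [e0 e1 eD]] : exists e, [/\ 0 < e, e <= 1 & e * D = 1 - t * p * r].
  exists ((1 - t * p * r) / D); split; first by rewrite divr_gt0; lra.
    by rewrite ler_pdivrMr; lra.
  by rewrite mulfVK //; lra.
exists ((t + e) * (p + e) * r).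
  apply/andP; split; first by rewrite !mulr_ge0 //; lra.
  have -> : (t + e) * (p + e) * r =
      t * p * r + e * ((t + p + 1) * r) + e * (e - 1) * r by ring.
  have -> : t * p * r = 1 - e * D by lra.
  rewrite -subr_gt0 [ltRHS](_ : _ = e * (t + p + 1) + e * (1 - e) * r).
    by rewrite ltr_pwDl ?mulr_gt0 // ?mulr_ge0 // ?mulr_ge0 //; lra.
  by rewrite /D; ring.
have [N1 _ TN] : \forall n \near \oo, (T n)%:R <= (t + e) ^+ n :> R.
  by apply: limn_esup_root_lt => //; rewrite -/(tau b) -taufin lte_fin ltrDl.
have [N2 _ MN] : \forall n \near \oo, M n <= (p + e) ^+ n.
  apply: limn_esup_root_lt; first exact: coef_max_ge0.
  by rewrite -/(rho b) -rhofin lte_fin ltrDl.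
exists (maxn N1 N2) => // n /=; rewrite geq_max => /andP[N1n N2n].
rewrite !exprMn; apply: ler_wpM2r; first exact: exprn_ge0.
by apply: ler_pM; rewrite ?coef_max_ge0 //; [exact: TN|exact: MN].
Qed.

(** Terms with a zero coefficient drop out, leaving exactly the binomials counted by [T n]; the
    factor [1/n!] from [norm_Snu_le] is absorbed into [M n]. *)
Lemma norm_homogeneous_part_le n (x : quat R) :
  `|\sum_(0 <= s < n.+1) Snu (s, n - s)%N x * b (s, n - s)%N|
  <= (T n)%:R * M n * norm1' x ^+ n.
Proof.
apply: le_trans (ler_norm_sum _ _ _) _.
rewrite /T natr_sum -mulrA mulr_suml [leRHS]big_mkcond !big_nat.
apply: ler_sum => s /andP[_]; rewrite ltnS => sn.
have [->|b_neq0] := eqVneq; first by rewrite mulr0 normr0.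
rewrite quat_normM.
apply: le_trans (ler_wpM2r (normr_ge0 _) (norm_Snu_le _ _)) _.
rewrite /= subnKC //; apply: le_trans (_ : _ <= 'C(n, s)%:R *
    (`|(n`!%:R^-1 : R) *: b (s, n - s)%N| * norm1' x ^+ n)) _.
  by rewrite normrZ ger0_norm ?invr_ge0 // !mulrA [leRHS]mulrAC.
apply: ler_wpM2l => //; apply: ler_wpM2r; last exact: le_coef_max.
by rewrite exprn_ge0 ?norm1'_ge0.
Qed.

End RadiusOfConvergence.

(** * Majorants on compact subsets of the domain *)

Theorem theorem6p0p4 (R : realType) (b : nat * nat -> quat R) :
  converges_compactly (partial_sum b) (conv_domain b).
Proof.
pose u n x := \sum_(0 <= s < n.+1) Snu (s, n - s)%N x * b (s, n - s)%N.
have [|g ug] := @weierstrass_M_test R (quat R) (quat R) u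
    (compactly_in (conv_domain b)).
  move=> A [AD cA].
  (* The extreme value theorem needs a nonempty set; on the empty set the zero majorant works. *)
  have [->|A0] := eqVneq A set0.
    exists (geometric 0 0); last by exists 0%N.
    by apply: is_cvg_geometric_series; rewrite normr0.
  have [||c] := @compact_EVT_max (quat R) R (@norm1' R) A _ cA.
  - exact/set0P.
  - exact/continuous_subspaceT/norm1'_continuous.
  (* The maximiser [c] lies in the domain, so [norm1' c] serves as the radius [r] for all of [A]. *)
  move=> /set_mem Ac xc; have [_ cD] := AD c Ac.
  have [q /andP[q0 q1] [N _ uq]] :=
    homogeneous_bound_geometric (norm1'_ge0 c) cD.
  exists (geometric 1 q).
    by apply: is_cvg_geometric_series; rewrite ger0_norm.
  exists N => // n Nn x Ax; rewrite /geometric /= mul1r.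
  apply: le_trans (norm_homogeneous_part_le b n x) _.
  apply: le_trans (uq n Nn); apply: ler_wpM2l; last first.
    by rewrite lerXn2r ?nnegrE ?norm1'_ge0 //; apply: xc; exact: mem_set.
  by rewrite mulr_ge0 ?coef_max_ge0.
(* [partial_sum b n] includes degree [n], whereas [series] stops just before its index, hence the
   shift to [n.+1]. *)
exists g; apply: cvg_trans ug => P [N _ NP].
by exists N => // n Nn; apply: (NP n.+1); apply: leq_trans Nn _.
Qed.
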